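(* $\sigma_c(L_\lambda)=[-2,2]$, where $\sigma_c(L_\lambda)$ denotes the continuous spectrum of the operator $L_\lambda$.
   Context: Standing assumptions: $(a_n)$, $(p_n)$, $(q_n)$, $n\in\mathbb{Z}$, are complex sequences with $a_n\neq0$ for all $n$ and $\sum_{n\in\mathbb{Z}}|n|(|1-a_n|+|p_n|+|q_n|)<\infty$. For $\lambda\in\mathbb{C}$, $L_\lambda$ is the (quadratic pencil) operator in $\ell^2(\mathbb{Z})$ given by $(L_\lambda y)_n=\Delta(a_{n-1}\Delta y_{n-1})+(q_n+2\lambda p_n+\lambda^2)y_n$, with $\Delta y_n=y_{n+1}-y_n$. Spectral notions are those of the pencil $\lambda\mapsto L_\lambda$: $\lambda$ is in the resolvent set if $L_\lambda^{-1}$ exists as a bounded operator on $\ell^2(\mathbb{Z})$; $\lambda$ is in the continuous spectrum if $L_\lambda$ is injective with dense range in $\ell^2(\mathbb{Z})$ but $L_\lambda^{-1}$ (defined on the range) is unbounded. *)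

(* Defs.v *)
From HB Require Import structures.
From mathcomp Require Import all_boot all_order all_algebra.
From mathcomp Require Import complex.
From mathcomp Require Import all_classical all_reals all_analysis.

Set Implicit Arguments.
Unset Strict Implicit.
Unset Printing Implicit Defensive.

Import Order.TTheory GRing.Theory Num.Theory.
Local Open Scope classical_set_scope.
Local Open Scope ring_scope.
Local Open Scope complex_scope.

(* The norm of the numFieldType [R[i]] is [R[i]]-valued; sums and estimates
   below need the [R]-valued modulus. *)
Notation cmod := ComplexField.Normc.normc.

Section Ell2.
Variable R : realType.
Implicit Types (f g y : int -> R[i]) (A : (int -> R[i]) -> (int -> R[i])).

Definition ell2 : set (int -> R[i]) :=
  [set y | summable [set: int] (fun n => (cmod (y n) ^+ 2)%:E)].

(* Meaningful on [ell2] only: [fine] sends an infinite sum to 0. *)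
Definition l2norm y : R :=
  Num.sqrt (fine (\esum_(n in [set: int]) (cmod (y n) ^+ 2)%:E)).

(* A map [A] on all sequences is regarded as an operator in [ell2] with its
   maximal domain. This is the whole of [ell2] when [A] maps [ell2] to itself,
   e.g. for a difference expression with bounded coefficients. *)
Definition l2_domain A : set (int -> R[i]) := [set y | ell2 y /\ ell2 (A y)].

Definition l2_range A : set (int -> R[i]) := A @` l2_domain A.

Definition l2_dense (S : set (int -> R[i])) : Prop :=
  forall f, ell2 f -> forall e : R, 0 < e ->
    exists2 g, S g & l2norm (f \- g) < e.

(* For [A] injective on its domain: boundedness of the inverse of [A] as an
   operator defined on [l2_range A], whose value at [A y] is [y]. *)
Definition l2_bounded_inverse A : Prop :=
  exists M : R, forall y, l2_domain A y -> l2norm y <= M * l2norm (A y).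

(* [T] is an operator pencil: the spectral parameter enters through the family
   [lam |-> T lam] itself, not through [T - lam]. *)
Definition continuous_spectrum (T : R[i] -> (int -> R[i]) -> (int -> R[i])) :
    set R[i] :=
  [set lam | [/\ set_inj (l2_domain (T lam)) (T lam),
                 l2_dense (l2_range (T lam)) &
                 ~ l2_bounded_inverse (T lam)]].

End Ell2.

Section Pencil.
Variable R : realType.

Definition fdiff (y : int -> R[i]) : int -> R[i] := fun n => y (n + 1) - y n.

Definition pencil (a p q : int -> R[i]) (lam : R[i]) (y : int -> R[i]) :
    int -> R[i] :=
  fun n => fdiff (fun m => a (m - 1) * fdiff y (m - 1)) n
           + (q n + 2 * lam * p n + lam ^+ 2) * y n.

End Pencil.

(* Main.v *)
(* Write [2 - lam^2 = z + z^-1], so that the unperturbed operator is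
   [T + T^-1 - (z + z^-1) = (T - z) (1 - z^-1 T^-1)] for the shift [T], and [L_lam]
   differs from it by coefficients [c n] with finite first moment.
   Off [[-2, 2]] one can take [|z| < 1]: the unperturbed operator is bounded below,
   so a bounded sequence along which [L_lam] tends to 0 has a nonzero pointwise limit
   in the kernel, and injectivity implies a bounded inverse.
   On [[-2, 2]], [|z| = 1].  A decaying solution bounded by [S] far out is bounded
   there by [S / 2], by two summations and the first moment condition, hence vanishes;
   since the formal transpose of [L_lam] is [L_lam], the triviality of the kernel also
   gives the density of the range.  Truncations of [n |-> z^n] to [k] sites
   have squared norm [k] and images of bounded norm. *)
Require Import Defs.
From mathcomp Require Import all_boot all_order all_algebra.
From mathcomp Require Import complex.
From mathcomp Require Import all_classical all_reals all_analysis.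
From mathcomp Require Import ring lra zify.
Import Order.TTheory GRing.Theory Num.Theory.
Import numFieldNormedType.Exports.
Local Open Scope classical_set_scope.
Local Open Scope ring_scope.
Local Open Scope complex_scope.

Set Implicit Arguments.
Unset Strict Implicit.

Local Notation Re := complex.Re.
Local Notation Im := complex.Im.

(** * Real-valued modulus on the complex numbers *)

Section Modulus.
Variable R : realType.
Implicit Types x y : R[i].

Lemma cmod_sqr x : cmod x ^+ 2 = Re x ^+ 2 + Im x ^+ 2.
Proof. by case: x => r s; rewrite /= sqr_sqrtr // addr_ge0 ?sqr_ge0. Qed.

Lemma cmod_ge0 x : 0 <= cmod x.
Proof. by case: x => r s; exact: sqrtr_ge0. Qed.

Lemma cmodJ x : cmod (x^*)%C = cmod x.
Proof. by case: x => r s /=; rewrite sqrrN. Qed.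

Lemma cmod_real (r : R) : cmod r%:C = `|r|.
Proof. by rewrite /= expr0n addr0 sqrtr_sqr. Qed.

Lemma cmodM x y : cmod (x * y) = cmod x * cmod y.
Proof. exact: Normc.normcM. Qed.

Lemma cmodD x y : cmod (x + y) <= cmod x + cmod y.
Proof. exact: (@le_normcD R). Qed.

Lemma cmodN x : cmod (- x) = cmod x.
Proof. exact: (@normcN R). Qed.

Lemma cmodB x y : cmod (x - y) <= cmod x + cmod y.
Proof. by rewrite -[cmod y]cmodN cmodD. Qed.

Lemma cmod0 : cmod (0 : R[i]) = 0.
Proof. exact: Normc.normc0. Qed.

Lemma cmod1_neq0 x : cmod x = 1 -> x != 0.
Proof. by move=> x1; apply/eqP => x0; move/eqP: x1; rewrite x0 cmod0 eq_sym oner_eq0. Qed.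

Lemma cmodX x n : cmod (x ^+ n) = cmod x ^+ n.
Proof.
elim: n => [|n IH]; first by rewrite !expr0 Normc.normc1.
by rewrite !exprS cmodM IH.
Qed.

End Modulus.

(** * Bounds on unconditional sums over the integers *)

Section SumsLe.
Variable R : realType.
Implicit Types (F G : int -> R) (C : R).

(** For nonnegative [F] this says that the unconditional sum is at most [C]. Finite sums over
    duplicate-free lists keep all estimates in [R], away from extended reals. *)
Definition sums_le F C := forall s : seq int, uniq s -> \sum_(n <- s) F n <= C.

Lemma esum_sums_le F C : (forall n, 0 <= F n) ->
  ((\esum_(n in [set: int]) (F n)%:E)%E <= C%:E)%E <-> sums_le F C.
Proof.
move=> F0; split=> [h s us|h].
  rewrite -lee_fin; apply: le_trans h; apply: esum_ge.
  exists [set` s]; first by split=> //; exact: finite_seq.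
  by rewrite -fsbig_seq// sumEFin.
apply: ge_ereal_sup => x [A [finA _] <-].
by rewrite fsbig_finite//= sumEFin lee_fin h// finmap.fset_uniq.
Qed.

Lemma sums_leD {F G C D} : sums_le F C -> sums_le G D ->
  sums_le (fun n => F n + G n) (C + D).
Proof. by move=> hF hG s us; rewrite big_split lerD ?hF ?hG. Qed.

Lemma sums_leZ {F C} (k : R) : 0 <= k -> sums_le F C ->
  sums_le (fun n => k * F n) (k * C).
Proof. by move=> k0 hF s us; rewrite -mulr_sumr ler_wpM2l ?hF. Qed.

Lemma sums_leW {F G C D} : (forall n, F n <= G n) -> C <= D -> sums_le G C ->
  sums_le F D.
Proof.
move=> FG CD hG s us; apply: le_trans CD; apply: le_trans (hG s us).
exact: ler_sum.
Qed.

Lemma sums_le_shift {F C} (k : int) : sums_le F C ->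
  sums_le (fun n => F (n + k)) C.
Proof.
move=> hF s us; rewrite -(big_map (fun n => n + k) xpredT F).
by apply: hF; rewrite map_inj_uniq// => x y /addIr.
Qed.

Lemma sums_le_ge0 {F C} : sums_le F C -> 0 <= C.
Proof. by move=> /(_ [::] isT); rewrite big_nil. Qed.

Lemma sums_le_term {F C} : sums_le F C -> forall n, F n <= C.
Proof. by move=> /(_ [:: _] isT) + n => /(_ n); rewrite big_seq1. Qed.

(** Allows a bound that holds on finitely many sites only to be added, by [sums_leD], to bounds over
    the whole line. *)
Lemma sums_le_finsupp F (s : seq int) : uniq s -> (forall n, 0 <= F n) ->
  sums_le (fun n => if n \in s then F n else 0) (\sum_(n <- s) F n).
Proof.
move=> us F0 t ut; rewrite -big_mkcond -big_filter.
rewrite [leRHS](bigID (mem t)) /= -[leLHS]addr0 lerD ?sumr_ge0//.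
rewrite -[leRHS]big_filter le_eqVlt; apply/orP; left; apply/eqP/perm_big.
apply: uniq_perm; rewrite ?filter_uniq// => n.
by rewrite !mem_filter andbC.
Qed.

End SumsLe.

(** * Square summability in terms of finite sums *)

Section Ell2Sums.
Variable R : realType.
Implicit Types (y : int -> R[i]) (C : R).

Definition l2sq y : R := fine (\esum_(n in [set: int]) (cmod (y n) ^+ 2)%:E).

(** Finiteness comes together with the bound, since [fine] sends an infinite sum to 0 and a bound on
    [l2sq] alone would say nothing. *)
Lemma sums_le_ell2 y C : sums_le (fun n => cmod (y n) ^+ 2) C ->
  ell2 y /\ l2sq y <= C.
Proof.
move/(esum_sums_le _ (fun n => sqr_ge0 (cmod (y n)))) => h.
split.
  rewrite /ell2/= /summable (le_lt_trans _ (ltry C))//.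
  by under eq_esum do rewrite gee0_abs ?lee_fin ?sqr_ge0//.
have e0 : (0 <= \esum_(n in [set: int]) (cmod (y n) ^+ 2)%:E)%E.
  by apply: esum_ge0 => n _; rewrite lee_fin sqr_ge0.
rewrite /l2sq -lee_fin fineK// ge0_fin_numE//.
by rewrite (le_lt_trans h) ?ltry.
Qed.

Lemma ell2_sums_le y : ell2 y -> sums_le (fun n => cmod (y n) ^+ 2) (l2sq y).
Proof.
move=> h; apply/esum_sums_le => [n|]; first exact: sqr_ge0.
rewrite /l2sq fineK// ge0_fin_numE.
  move: h; rewrite /ell2/= /summable.
  by under eq_esum do rewrite gee0_abs ?lee_fin ?sqr_ge0//.
by apply: esum_ge0 => n _; rewrite lee_fin sqr_ge0.
Qed.

Lemma l2sq_ge0 y : 0 <= l2sq y.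
Proof. by rewrite fine_ge0// esum_ge0// => n _; rewrite lee_fin sqr_ge0. Qed.

Lemma sqr_l2norm y : l2norm y ^+ 2 = l2sq y.
Proof. by rewrite sqr_sqrtr ?l2sq_ge0. Qed.

Lemma l2norm_lt y (e : R) : 0 < e -> (l2norm y < e) = (l2sq y < e ^+ 2).
Proof. by move=> e0; rewrite -sqr_l2norm ltr_pXn2r ?nnegrE ?sqrtr_ge0 ?ltW. Qed.

Lemma cmod_le_l2sq y n : ell2 y -> cmod (y n) ^+ 2 <= l2sq y.
Proof. by move/ell2_sums_le/sums_le_term. Qed.

End Ell2Sums.

(** * Pointwise limits along an ultrafilter *)

Section UltraLimits.
Variable R : realType.

(** By compactness of the segment the image filter has a cluster point, and an ultrafilter converges
    to each of its cluster points. *)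
Lemma ultra_bounded_cvg (U : set_system nat) (u : nat -> R) (M : R) :
  UltraFilter U -> (forall k, `|u k| <= M) -> exists l : R, u @ U --> l.
Proof.
move=> UU uM.
have uI : (u @ U) [set` `[- M, M]].
  apply: (@filterE _ U) => k; rewrite /= in_itv /= -ler_norml; exact: uM.
have [l [_ ul]] := @segment_compact R (- M) M (u @ U) _ uI.
exists l => V Vl; rewrite /nbhs /=.
have [//|UV] := in_ultra_setVsetC (u @^-1` V) UU.
by have [x [xV /xV]] := ul (~` V) V UV Vl.
Qed.

Definition ccvg (U : set_system nat) (s : nat -> R[i]) (l : R[i]) :=
  (Re (s k) @[k --> U] --> (Re l : R)) /\ (Im (s k) @[k --> U] --> (Im l : R)).

(** A single ultrafilter serves all sites at once, so no diagonal subsequence is extracted. *)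
Lemma ultra_ccvg (U : set_system nat) (w : nat -> int -> R[i]) (M : R) :
  UltraFilter U -> (forall k n, cmod (w k n) ^+ 2 <= M) ->
  exists W, forall n, ccvg U (w ^~ n) (W n).
Proof.
move=> UU wM.
(* From (|r| - 1/2)^2 >= 0 one has |r| <= r^2 + 1/4. *)
have le_norm (r t : R) : r ^+ 2 + t ^+ 2 <= M -> `|r| <= M + 1.
  move=> h; rewrite ler_norml; have := sqr_ge0 t; have := sqr_ge0 (r - 1/2).
  by have := sqr_ge0 (r + 1/2); move: h; rewrite !expr2 => *; apply/andP; split; lra.
have /choice[x xP] : forall n, exists l : R, Re (w k n) @[k --> U] --> l.
  move=> n; apply: (@ultra_bounded_cvg _ _ (M + 1)) => k.
  by apply: (le_norm _ (Im (w k n))); rewrite -cmod_sqr.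
have /choice[t tP] : forall n, exists l : R, Im (w k n) @[k --> U] --> l.
  move=> n; apply: (@ultra_bounded_cvg _ _ (M + 1)) => k.
  by apply: (le_norm _ (Re (w k n))); rewrite addrC -cmod_sqr.
by exists (fun n => x n +i* t n).
Qed.

Context (U : set_system nat) {UU : UltraFilter U}.
Implicit Types (s : nat -> R[i]) (l c : R[i]).

Lemma ccvgD s1 s2 l1 l2 : ccvg U s1 l1 -> ccvg U s2 l2 ->
  ccvg U (fun k => s1 k + s2 k) (l1 + l2).
Proof.
move=> [r1 i1] [r2 i2]; split; rewrite raddfD.
  by under eq_cvg do rewrite raddfD; exact: cvgD.
by under eq_cvg do rewrite raddfD; exact: cvgD.
Qed.

Lemma ccvgM c s l : ccvg U s l -> ccvg U (fun k => c * s k) (c * l).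
Proof.
have reM (x y : R[i]) : Re (x * y) = Re x * Re y - Im x * Im y by case: x; case: y.
have imM (x y : R[i]) : Im (x * y) = Re x * Im y + Im x * Re y by case: x; case: y.
move=> [r i]; split.
  rewrite reM; under eq_cvg do rewrite reM.
  by apply: cvgB; apply: cvgM => //; exact: cvg_cst.
rewrite imM; under eq_cvg do rewrite imM.
by apply: cvgD; apply: cvgM => //; exact: cvg_cst.
Qed.

Lemma ccvg_sqr s l : ccvg U s l -> (cmod (s k) ^+ 2) @[k --> U] --> cmod l ^+ 2.
Proof.
move=> [r i]; rewrite cmod_sqr; under eq_cvg do rewrite cmod_sqr.
by rewrite !expr2; apply: cvgD; apply: cvgM.
Qed.

Lemma ccvg_sqr_sum w W (t : seq int) : (forall n, ccvg U (w ^~ n) (W n)) ->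
  \sum_(n <- t) cmod (w k n) ^+ 2 @[k --> U] --> \sum_(n <- t) cmod (W n) ^+ 2.
Proof.
move=> wW; elim: t => [|n t IH].
  by rewrite big_nil; under eq_cvg do rewrite big_nil; exact: cvg_cst.
rewrite big_cons; under eq_cvg do rewrite big_cons.
by apply: cvgD => //; exact: ccvg_sqr.
Qed.

(** Fatou's inequality for pointwise limits: each finite sum passes to the limit. *)
Lemma sums_le_ccvg w W (M : R) : (forall n, ccvg U (w ^~ n) (W n)) ->
  (forall k, sums_le (fun n => cmod (w k n) ^+ 2) M) ->
  sums_le (fun n => cmod (W n) ^+ 2) M.
Proof.
move=> wW wM t ut; apply: (cvgr_to_le (@ccvg_sqr_sum w W t wW)).
by apply: filterE => k; exact: wM.
Qed.

End UltraLimits.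

Lemma ex_ultrafilter_nat : exists U : set_system nat,
  UltraFilter U /\ (forall N, U [set k | (N <= k)%N]).
Proof.
have [U [UU sU]] := @ultraFilterLemma nat \oo _.
by exists U; split=> // N; apply: sU; exact: nbhs_infty_ge.
Qed.

(** * Least bounds and a contraction estimate *)

Section SumsInf.
Variable R : realType.
Implicit Types (F f g : int -> R) (C : R).

Lemma sums_le_min F C : sums_le F C ->
  exists2 S, sums_le F S & forall D, sums_le F D -> S <= D.
Proof.
move=> FC; pose E := [set \sum_(n <- s) F n | s in [set s | uniq s]].
have E0 : E !=set0 by exists 0; exists [::]; rewrite ?big_nil.
exists (sup E) => [s us|D FD].
  by apply: ub_le_sup; [exists C => _ [t ut <-]; exact: FC|exists s].
by apply: ge_sup => // _ [t ut <-]; exact: FD.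
Qed.

(* [(r x + b)^2 <= r x^2 + b^2 / (1 - r)] by convexity, so summing turns the
   hypothesis into [S <= r S + G / (1 - r)] for [S] the sum of squares of [f]. *)
Lemma sums_le_contraction f g (k : int) (r F G : R) : 0 <= r < 1 ->
  (forall n, 0 <= f n) -> (forall n, f n <= r * f (n + k) + g n) ->
  sums_le (fun n => f n ^+ 2) F -> sums_le (fun n => g n ^+ 2) G ->
  sums_le (fun n => f n ^+ 2) (G / (1 - r) ^+ 2).
Proof.
move=> /andP[r0 r1] f0 fg /sums_le_min[S fS Smin] gG.
have r1' : 0 < 1 - r by rewrite subr_gt0.
have : S <= r * S + (1 - r)^-1 * G.
  apply: Smin; apply: (sums_leW _ (lexx _) (sums_leD
    (sums_leZ r0 (sums_le_shift k fS)) (sums_leZ _ gG))); last first.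
    by rewrite invr_ge0 ltW.
  move=> n /=; apply: (@le_trans _ _ ((r * f (n + k) + g n) ^+ 2)).
    by rewrite ler_pXn2r ?nnegrE ?(le_trans (f0 n)).
  rewrite -subr_ge0 [leRHS](_ : _ =
    r / (1 - r) * ((1 - r) * f (n + k) - g n) ^+ 2); last first.
    by field; rewrite gt_eqF.
  by rewrite mulr_ge0 ?sqr_ge0// divr_ge0// ltW.
move=> h; apply: sums_leW fS => //.
rewrite ler_pdivlMr ?exprn_gt0//.
have -> : G = (1 - r) * ((1 - r)^-1 * G) by rewrite mulrA divff ?mul1r// gt_eqF.
by rewrite expr2 mulrA [leLHS]mulrC ler_pM2l//; lra.
Qed.

End SumsInf.

(** * Three-term operators close to the free one *)

Section Jacobi.
Variable R : realType.
Implicit Types (a v y w : int -> R[i]) (c : int -> R).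

Definition jacobi a v y : int -> R[i] := fun n =>
  a n * (y (n + 1) - y n) - a (n - 1) * (y n - y (n - 1)) + v n * y n.

Lemma pencilE a p q (lam : R[i]) :
  pencil a p q lam = jacobi a (fun n => q n + 2 * lam * p n + lam ^+ 2).
Proof.
by apply/funext => y; apply/funext => n; rewrite /pencil /fdiff /jacobi !addrK ?subrK.
Qed.

Lemma jacobiB a v y w : jacobi a v (y \- w) = jacobi a v y \- jacobi a v w.
Proof. by apply/funext => n; rewrite /jacobi /=; ring. Qed.

Lemma jacobiD a v y w : jacobi a v (y \+ w) = jacobi a v y \+ jacobi a v w.
Proof. by apply/funext => n; rewrite /jacobi /=; ring. Qed.

Lemma jacobiZ a v (k : R[i]) y :
  jacobi a v (fun n => k * y n) = fun n => k * jacobi a v y n.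
Proof. by apply/funext => n; rewrite /jacobi /=; ring. Qed.

Lemma jacobi_ccvg (U : set_system nat) {UU : UltraFilter U}
    a v (s : nat -> int -> R[i]) y n :
  (forall m, ccvg U (s ^~ m) (y m)) ->
  ccvg U (fun k => jacobi a v (s k) n) (jacobi a v y n).
Proof.
move=> sy.
have E t : jacobi a v t n =
    a n * t (n + 1) + ((v n - a n - a (n - 1)) * t n + a (n - 1) * t (n - 1)).
  by rewrite /jacobi; ring.
rewrite E (_ : (fun k => _) = fun k => a n * s k (n + 1) +
   ((v n - a n - a (n - 1)) * s k n + a (n - 1) * s k (n - 1))); last first.
  by apply/funext => k; exact: E.
by apply: ccvgD; [|apply: ccvgD]; apply: ccvgM.
Qed.

Definition free_op (z : R[i]) y : int -> R[i] := fun n =>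
  y (n + 1) + y (n - 1) - (z + z^-1) * y n.

Definition stencil y n := cmod (y (n - 1)) + cmod (y n) + cmod (y (n + 1)).
Definition stencil2 y n :=
  cmod (y (n - 1)) ^+ 2 + cmod (y n) ^+ 2 + cmod (y (n + 1)) ^+ 2.

Lemma stencil_sqr y n : stencil y n ^+ 2 <= 3 * stencil2 y n.
Proof.
rewrite /stencil /stencil2; move: (cmod _) (cmod _) (cmod _) => r s t.
have := sqr_ge0 (r - s); have := sqr_ge0 (s - t); have := sqr_ge0 (r - t).
by rewrite !expr2; lra.
Qed.

Lemma stencil2_ge0 y n : 0 <= stencil2 y n.
Proof. by rewrite /stencil2 !addr_ge0 ?sqr_ge0. Qed.

Lemma stencil_ge0 y n : 0 <= stencil y n.
Proof. by rewrite /stencil !addr_ge0 ?cmod_ge0. Qed.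

Lemma sums_le_stencil2 y C : sums_le (fun n => cmod (y n) ^+ 2) C ->
  sums_le (stencil2 y) (C + C + C).
Proof.
move=> h; exact: sums_leD (sums_leD (sums_le_shift (- 1) h) h) (sums_le_shift 1 h).
Qed.

(** The local form of a perturbation of [free_op]: the error at a site involves the three values of
    [y] around it, with weight [c n]. *)
Definition near_free a v (z : R[i]) c := forall y n,
  cmod (jacobi a v y n - free_op z y n) <= c n * stencil y n.

Lemma free_op_factor z y n : z != 0 ->
  free_op z y n = (y (n + 1) - z * y n) - z^-1 * (y n - z * y (n - 1)).
Proof. by move=> z0; rewrite /free_op; field. Qed.

(** The two first-order factors are inverted one after the other, each by a contraction of ratio |z|
    that costs a factor 1 / (1 - |z|)^2. The bound [Y] supplies the finiteness that the contraction
    argument starts from; it does not enter the result. *)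
Lemma free_op_bound z y (Y G : R) : z != 0 -> cmod z < 1 ->
  sums_le (fun n => cmod (y n) ^+ 2) Y ->
  sums_le (fun n => cmod (free_op z y n) ^+ 2) G ->
  sums_le (fun n => cmod (y n) ^+ 2) (G / (1 - cmod z) ^+ 4).
Proof.
move=> z0 z1 yY gG; have r0 := cmod_ge0 z.
pose u n := y (n + 1) - z * y n.
have r01 : 0 <= cmod z < 1 by rewrite r0.
have uF : sums_le (fun n => cmod (u n) ^+ 2) (2 * Y + 2 * Y).
  apply: (sums_leW _ (lexx _) (sums_leD (sums_leZ (ler0n _ 2) (sums_le_shift 1 yY))
     (sums_leZ (ler0n _ 2) yY))) => n /=.
  have le1 : cmod (u n) <= cmod (y (n + 1)) + cmod (y n).
    rewrite (le_trans (cmodB _ _))// lerD2l cmodM ler_piMl ?cmod_ge0// ltW//.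
  have := cmod_ge0 (u n); move: le1; have := sqr_ge0 (cmod (y (n + 1)) - cmod (y n)).
  by rewrite !expr2; nra.
have uG : sums_le (fun n => cmod (u n) ^+ 2) (G / (1 - cmod z) ^+ 2).
  apply: (sums_le_contraction (k := 1) r01 _ _ uF (sums_le_shift 1 gG)) => n.
    exact: cmod_ge0.
  (* This factor is solved from the right and the other one from the left, so that each recursion
     multiplies by z rather than by its inverse. *)
  have -> : u n = z * u (n + 1) - z * free_op z y (n + 1).
    by rewrite free_op_factor// /u addrK; field.
  rewrite (le_trans (cmodB _ _))// !cmodM lerD2l ler_piMl ?cmod_ge0// ltW//.
have -> : G / (1 - cmod z) ^+ 4 = G / (1 - cmod z) ^+ 2 / (1 - cmod z) ^+ 2.
  by field; rewrite subr_eq0 gt_eqF.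
apply: (sums_le_contraction (k := -1) r01 _ _ yY (sums_le_shift (-1) uG)) => n.
  exact: cmod_ge0.
rewrite -cmodM -[X in cmod X <= _](_ : z * y (n - 1) + u (n - 1) = y n) ?cmodD//.
by rewrite /u subrK; ring.
Qed.

(** The weight 1 + |n| instead of |n| makes [C] bound the first moment, the plain sum and each
    [c n]. *)
Definition weight_summable c (C : R) :=
  (forall n, 0 <= c n) /\ sums_le (fun n => (1 + `|n|%:~R) * c n) C.

Lemma weight_summable_le c C n : weight_summable c C -> (1 + `|n|%:~R) * c n <= C.
Proof. by case=> _ /sums_le_term; exact. Qed.

Lemma weight_summable_bnd c C n : weight_summable c C -> c n <= C.
Proof.
move=> h; apply: le_trans (weight_summable_le n h).
have : 0 <= `|n|%:~R :> R by rewrite ler0z.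
by have := (h.1 n); nra.
Qed.

(** Multiplying |n| c n <= C by c n <= C gives |n| (c n)^2 <= C^2, so all |n| >= C^2 / d qualify;
    [t] lists the integers from -N to N. *)
Lemma weight_summable_small c C (d : R) : 0 < d -> weight_summable c C ->
  exists2 t : seq int, uniq t & forall n : int, n \notin t -> c n ^+ 2 <= d.
Proof.
move=> d0 h; have Cd : 0 <= C ^+ 2 / d by rewrite divr_ge0 ?sqr_ge0 ?ltW.
have NP := archi_boundP Cd; set N := Num.bound _ in NP.
exists [seq (i%:Z - N%:Z) | i <- iota 0 N.*2.+1].
  by rewrite map_inj_uniq ?iota_uniq// => i j /= ?; lia.
move=> n /mapP nt.
have nN : (N%:Z <= `|n|).
  rewrite leNgt; apply/negP => hn; apply: nt; exists (absz (n + N%:Z)); last by lia.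
  by rewrite mem_iota; lia.
have nNR : N%:R <= `|n|%:~R :> R by rewrite -[N%:R]/(N%:Z%:~R) ler_int.
have h1 := weight_summable_le n h; have h2 := weight_summable_bnd n h; have h3 := h.1 n.
move: NP; rewrite ltr_pdivrMr// => NP.
have C0 : 0 <= C by apply: le_trans h2.
have N1 : 0 < N%:R :> R.
  by rewrite ltNge; apply/negP => N1; have := sqr_ge0 C; nra.
rewrite -(ler_pM2l N1); apply: le_trans (ltW NP); rewrite !expr2.
apply: le_trans (ler_pM _ _ h1 h2) => //; last first.
  by rewrite mulr_ge0// addr_ge0// (le_trans _ nNR) ?ler0n.
by rewrite mulrA ler_wpM2r// ler_wpM2r//; lra.
Qed.

End Jacobi.

(** * The case [|z| < 1] *)

Section Outside.
Variable R : realType.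
Implicit Types (a v y w : int -> R[i]) (c : int -> R).

(** The perturbation is small outside a finite set [t] independent of [y]; there it is absorbed into
    the lower bound for [free_op], and on [t] it stays as a finite sum. *)
Lemma jacobi_apriori a v (z : R[i]) c C : near_free a v z c ->
  weight_summable c C -> z != 0 -> cmod z < 1 ->
  exists A B (t : seq int), [/\ 0 <= A, uniq t & forall y, ell2 y -> ell2 (jacobi a v y) ->
   l2sq y <= A * l2sq (jacobi a v y) + B * \sum_(n <- t) stencil2 y n].
Proof.
move=> nf ws z0 z1; have r0 := cmod_ge0 z.
set K := (1 - cmod z) ^+ 4.
have K0 : 0 < K by rewrite exprn_gt0// subr_gt0.
(* The error enters as 6 (c n)^2 [stencil2], and [stencil2] sums to at most 3 Y. With (c n)^2 <= K /
   36 this is K Y / 2, half of the left side K Y. *)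
have [|t ut tP] := @weight_summable_small _ c C (K / 36) _ ws.
  by rewrite divr_gt0.
exists (4 / K), (12 * C ^+ 2 / K), t; split=> //; first by rewrite divr_ge0 ?ltW.
move=> y /ell2_sums_le yY /ell2_sums_le gG.
set Y := l2sq y in yY *; set G := l2sq _ in gG *; set T := \sum_(n <- t) _.
pose D := 2 * G + (K / 6 * (Y + Y + Y) + 6 * C ^+ 2 * T).
have D0 : sums_le (fun n => cmod (free_op z y n) ^+ 2) D.
  apply: (sums_leW _ (lexx _) (sums_leD (sums_leZ (ler0n _ 2) gG) (sums_leD
     (sums_leZ _ (sums_le_stencil2 yY))
     (sums_leZ _ (sums_le_finsupp ut (stencil2_ge0 y)))))); last 2 first.
  - by rewrite divr_ge0 ?ltW.
  - by rewrite mulr_ge0 ?sqr_ge0.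
  move=> n /=.
  have le1 : cmod (free_op z y n) <= cmod (jacobi a v y n) + c n * stencil y n.
    rewrite -[free_op z y n](subKr (jacobi a v y n)).
    by rewrite (le_trans (cmodB _ _))// lerD2l nf.
  have c0 := ws.1 n; have s0 := stencil_ge0 y n; have s2 := stencil_sqr y n.
  have s20 := stencil2_ge0 y n.
  have le2 : cmod (free_op z y n) ^+ 2 <=
      2 * cmod (jacobi a v y n) ^+ 2 + 6 * (c n ^+ 2 * stencil2 y n).
    have h0 := cmod_ge0 (free_op z y n).
    have h3 : (c n * stencil y n) ^+ 2 <= 3 * (c n ^+ 2 * stencil2 y n).
      by rewrite exprMn [leRHS]mulrCA ler_wpM2l ?sqr_ge0.
    have h4 : cmod (free_op z y n) ^+ 2 <= (cmod (jacobi a v y n) + c n * stencil y n) ^+ 2.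
      by rewrite ler_pXn2r ?nnegrE// (le_trans h0).
    have h5 := sqr_ge0 (cmod (jacobi a v y n) - c n * stencil y n).
    apply: (le_trans h4); move: h3 h5.
    move: (c n * stencil y n) (cmod _) => b x; rewrite sqrrB sqrrD; lra.
  apply: (le_trans le2); rewrite lerD2l.
  case: ifPn => nt.
    have : c n ^+ 2 <= C ^+ 2.
      have cC := weight_summable_bnd n ws.
      by rewrite ler_pXn2r ?nnegrE// (le_trans c0).
    move=> /(ler_wpM2r s20) h.
    have : 0 <= K / 6 * stencil2 y n by rewrite mulr_ge0// divr_ge0 ?ltW.
    lra.
  by have := ler_wpM2r s20 (tP n nt); lra.
have [_] := sums_le_ell2 (free_op_bound z0 z1 yY D0).
rewrite -/Y -/K ler_pdivlMr//.
have T0 : 0 <= T by apply: sumr_ge0 => n _; exact: stencil2_ge0.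
have -> : 4 / K * G + 12 * C ^+ 2 / K * T = (4 * G + 12 * C ^+ 2 * T) / K by lra.
by rewrite ler_pdivlMr// /D; nra.
Qed.

(** Without a bounded inverse there are vectors of norm 1 with images tending to 0. The a priori
    estimate keeps part of their mass on the finite set [t], so their pointwise limit is a nonzero
    kernel element. *)
Lemma jacobi_bounded_inverse a v (z : R[i]) c C : near_free a v z c ->
  weight_summable c C -> z != 0 -> cmod z < 1 ->
  set_inj (l2_domain (jacobi a v)) (jacobi a v) ->
  l2_bounded_inverse (jacobi a v).
Proof.
move=> nf ws z0 z1 inj; apply: contrapT => nb.
have [A [B [t [A0 ut apr]]]] := jacobi_apriori nf ws z0 z1.
have /choice[w wP] : forall k : nat, exists w : int -> R[i],
   [/\ sums_le (fun n => cmod (w n) ^+ 2) 1,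
       sums_le (fun n => cmod (jacobi a v w n) ^+ 2) (k.+1%:R^-1) &
       1 <= A * k.+1%:R^-1 + B * \sum_(n <- t) stencil2 w n].
  move=> k; apply: contrapT => nw; apply: nb.
  (* A vector violating the bound k + 1, divided by its norm, serves as [w]; its image has squared
     norm at most 1 / (k + 1)^2 <= 1 / (k + 1). *)
  exists k.+1%:R => y [yl Lyl]; rewrite leNgt; apply/negP => lt_y; apply: nw.
  have m0 : 0 < l2norm y.
    by apply: le_lt_trans lt_y; rewrite mulr_ge0 ?sqrtr_ge0.
  set m := l2norm y in lt_y m0.
  have m2 : l2sq y = m ^+ 2 by rewrite sqr_l2norm.
  have mi : 0 < m^-1 ^+ 2 by rewrite exprn_gt0 ?invr_gt0.
  have mm : m^-1 ^+ 2 * m ^+ 2 = 1 by rewrite -exprMn mulVf ?expr1n// gt_eqF.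
  have cmodZ (x : R[i]) : cmod (m^-1%:C * x) ^+ 2 = m^-1 ^+ 2 * cmod x ^+ 2.
    by rewrite cmodM cmod_real exprMn ger0_norm// invr_ge0 ltW.
  have Ly : l2sq (jacobi a v y) <= k.+1%:R^-1 * m ^+ 2.
    have k1 : 1 <= k.+1%:R :> R by rewrite ler1n.
    rewrite -sqr_l2norm mulrC ler_pdivlMr ?ltr0n//; have := sqrtr_ge0 (l2sq (jacobi a v y)).
    rewrite -/(l2norm _) => n0; move: lt_y => /ltW lt_y.
    apply: (@le_trans _ _ ((k.+1%:R * l2norm (jacobi a v y)) ^+ 2)).
      by rewrite exprMn mulrC ler_wpM2r ?sqr_ge0// expr2; nra.
    by rewrite ler_pXn2r ?nnegrE ?mulr_ge0 ?(ltW m0).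
  have mk : m^-1 ^+ 2 * (k.+1%:R^-1 * m ^+ 2) = k.+1%:R^-1.
    transitivity (k.+1%:R^-1 * (m^-1 ^+ 2 * m ^+ 2)); first by ring.
    by rewrite mm mulr1.
  rewrite -(ler_pM2l mi) mk in Ly.
  exists (fun n => m^-1%:C * y n); split.
  - apply: (sums_leW _ _ (sums_leZ (ltW mi) (ell2_sums_le yl))) => [n|].
      by rewrite cmodZ.
    by rewrite m2 mm.
  - apply: (sums_leW _ _ (sums_leZ (ltW mi) (ell2_sums_le Lyl))) => [n|].
      by rewrite jacobiZ cmodZ.
    exact: Ly.
  - have := ler_wpM2l (ltW mi) (apr y yl Lyl); rewrite m2 mm => /le_trans; apply.
    have -> : \sum_(n <- t) stencil2 (fun n => m^-1%:C * y n) n =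
        m^-1 ^+ 2 * \sum_(n <- t) stencil2 y n.
      rewrite mulr_sumr; apply: eq_bigr => n _.
      by rewrite /stencil2 !cmodZ; ring.
    have := ler_wpM2l A0 Ly; move: (m^-1 ^+ 2) (k.+1%:R^-1) (l2sq _) (\sum_(n <- t) _).
    by move=> i j G T; lra.
have [U [UU Uinf]] := ex_ultrafilter_nat.
have [|W wW] := @ultra_ccvg R U w 1 UU.
  by move=> k n; have [/sums_le_term + _ _] := wP k; exact.
have W1 : sums_le (fun n => cmod (W n) ^+ 2) 1.
  by apply: (sums_le_ccvg wW) => k; have [] := wP k.
have LW n : jacobi a v W n = 0.
  apply: Normc.eq0_normc; apply/eqP; rewrite -sqrf_eq0 eq_le sqr_ge0 andbT.
  apply/ler_addgt0Pl => e e0; rewrite addr0.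
  apply: (cvgr_to_le (ccvg_sqr (jacobi_ccvg a v n wW))).
  apply: (@filterS _ U _ _ _ _ (Uinf (Num.bound e^-1))) => k /= ek.
  have [_ /sums_le_term/(_ n) h _] := wP k.
  apply: (le_trans h); rewrite invf_ple ?posrE//.
  have ei : 0 <= e^-1 by rewrite invr_ge0 ltW.
  by rewrite (le_trans (ltW (archi_boundP ei)))// ler_nat leqW.
have LW0 : jacobi a v W = (fun=> 0) by apply/funext.
have ell20 : ell2 (fun=> 0 : R[i]).
  have [] // := @sums_le_ell2 R (fun=> 0) 0 => s us.
  by rewrite big1// => n _; rewrite cmod0 expr0n.
have W0 : W = (fun=> 0).
  apply: inj; rewrite ?inE.
  - by split; [have [] := sums_le_ell2 W1|rewrite LW0].
  - split=> //; rewrite (_ : jacobi a v _ = fun=> 0)//.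
    by apply/funext => n; rewrite /jacobi; ring.
  - by rewrite LW0; apply/funext => n; rewrite /jacobi; ring.
(* Once k >= 2 A, the term A / (k + 1) is at most 1/2, so the sum over [t] carries the other half;
   being finite, it passes to the limit. *)
have : 1/2 <= B * \sum_(n <- t) stencil2 W n.
  have cv : (fun k => B * \sum_(n <- t) stencil2 (w k) n) @ U -->
      B * \sum_(n <- t) stencil2 W n.
    apply: cvgM; first exact: cvg_cst.
    have E y : \sum_(n <- t) stencil2 y n =
       \sum_(n <- [seq n - 1 | n <- t]) cmod (y n) ^+ 2 +
       \sum_(n <- t) cmod (y n) ^+ 2 +
       \sum_(n <- [seq n + 1 | n <- t]) cmod (y n) ^+ 2.
      by rewrite !big_map -!big_split.
    rewrite E; under eq_cvg do rewrite E.
    by apply: cvgD; [apply: cvgD|]; exact: ccvg_sqr_sum.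
  apply: (cvgr_to_ge cv).
  apply: (@filterS _ U _ _ _ _ (Uinf (Num.bound (2 * A)))) => k /= kA.
  have [_ _ h] := wP k.
  have : A * k.+1%:R^-1 <= 1/2.
    rewrite ler_pdivrMr ?ltr0n//.
    have : 2 * A <= k.+1%:R.
      have A2 : 0 <= 2 * A by rewrite mulr_ge0.
      by rewrite (le_trans (ltW (archi_boundP A2)))// ler_nat leqW.
    by lra.
  by move: h => /=; move: (\sum_(n <- t) _) (A * _) => T S; lra.
rewrite W0 big1 ?mulr0 ?ler_pdivrMr ?mul0r ?ler10//.
by move=> n _; rewrite /stencil2 cmod0 expr0n /= !addr0.
Qed.

End Outside.

(** * The case [|z| = 1]: kernel and unbounded inverse *)

Section SumsTail.
Variable R : realType.

(** A list [t] whose sum exceeds the least bound minus [e] leaves at most [e] for any list disjoint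
    from it. *)
Lemma sums_le_tail (F : int -> R) (C e : R) : 0 < e -> sums_le F C ->
  exists t : seq int, forall s : seq int, uniq s -> (forall n : int, n \in s -> n \notin t) ->
    \sum_(n <- s) F n <= e.
Proof.
move=> e0 /sums_le_min[S FS Smin].
have [t [ut tS]] : exists t : seq int, uniq t /\ S - e < \sum_(n <- t) F n.
  apply: contrapT => nt; suff : S <= S - e by lra.
  by apply: Smin => t ut; rewrite leNgt; apply/negP => h; apply: nt; exists t.
exists t => s us st.
have := FS (t ++ s); rewrite cat_uniq ut us andbT /= big_cat /=.
have -> : ~~ has (mem t) s by apply/hasPn => n /st.
by move=> /(_ isT); lra.
Qed.

End SumsTail.

(** * Two summations along a half-line under a first moment bound *)

Section Halving.
Variables (R : realType) (alpha beta gamma : nat -> R) (n0 : nat) (S eps : R).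
Hypothesis beta_ge0 : forall m, 0 <= beta m.
Hypothesis gamma_ge0 : forall m, 0 <= gamma m.
Hypothesis alphaS : forall m, (n0 <= m)%N -> alpha m <= alpha m.+1 + beta m.
Hypothesis betaS : forall m, (n0 <= m)%N -> beta m <= beta m.+1 + S * gamma m.+1.
Hypothesis alpha_cvg : forall e, 0 < e -> exists N, forall m, (N <= m)%N -> alpha m <= e.
Hypothesis beta_cvg : forall e, 0 < e -> exists N, forall m, (N <= m)%N -> beta m <= e.
Hypothesis S0 : 0 <= S.
Hypothesis gamma_sum : forall n N, (n0 <= n)%N -> \sum_(n <= m < N) m%:R * gamma m <= eps.

(** Since [beta] tends to 0, beta k is at most S times the sum of gamma m over m > k; there k + 1 <=
    m, so the factor k + 1 turns this tail into a first moment. *)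
Lemma first_moment_beta k : (n0 <= k)%N -> k.+1%:R * beta k <= S * eps.
Proof.
move=> nk; apply/ler_addgt0Pr => e e0.
have step N : (k <= N)%N -> k.+1%:R * beta k <=
    k.+1%:R * beta N + S * \sum_(k.+1 <= m < N.+1) m%:R * gamma m.
  move=> /subnKC <-; elim: (N - k)%N => [|j IH].
    by rewrite addn0 big_geq// mulr0 addr0.
  apply: (le_trans IH); rewrite addnS [in leRHS]big_nat_recr ?ltnS ?leqW ?leq_addr//=.
  have /betaS : (n0 <= k + j)%N by rewrite (leq_trans nk)// leq_addr.
  move=> /(ler_wpM2l (ler0n R k.+1)) h.
  have : k.+1%:R * (S * gamma (k + j).+1) <= S * ((k + j).+1%:R * gamma (k + j).+1).
    rewrite mulrCA ler_wpM2l// ler_wpM2r// ler_nat.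
    by rewrite ltnS leq_addr.
  by lra.
have k0 : 0 < k.+1%:R :> R by rewrite ltr0n.
have [N NP] := @beta_cvg (e / k.+1%:R) (divr_gt0 e0 k0).
apply: (le_trans (step _ (leq_maxl k N))).
rewrite addrC lerD//; last by rewrite mulrC -ler_pdivlMr// NP// leq_maxr.
by rewrite ler_wpM2l// gamma_sum// leqW.
Qed.

(* The quantity [alpha m + (m - n) beta m] grows by at most
   [S (m.+1) gamma (m.+1)] when [m] decreases by one. *)
Lemma first_moment_alpha n : (n0 <= n)%N -> alpha n <= 2 * (S * eps).
Proof.
move=> nn; apply/ler_addgt0Pr => e e0.
have step N : (n <= N)%N -> alpha n <=
    alpha N + (N - n)%:R * beta N + S * \sum_(n.+1 <= m < N.+1) m%:R * gamma m.
  move=> /subnKC <-; elim: (N - n)%N => [|j IH].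
    by rewrite addn0 subnn mul0r big_geq// mulr0 !addr0.
  apply: (le_trans IH); rewrite addnS [in leRHS]big_nat_recr ?ltnS ?leqW ?leq_addr//=.
  rewrite -addnS !addKn addnS.
  have nj : (n0 <= n + j)%N by rewrite (leq_trans nn)// leq_addr.
  have h1 := alphaS nj.
  have h2 := ler_wpM2l (ler0n R j.+1) (betaS nj).
  have : j.+1%:R * (S * gamma (n + j).+1) <= S * ((n + j).+1%:R * gamma (n + j).+1).
    rewrite mulrCA ler_wpM2l// ler_wpM2r// ler_nat.
    by rewrite ltnS leq_addl.
  have e1 : j.+1%:R = j%:R + 1 :> R by rewrite -natr1.
  move: h2; rewrite e1; lra.
have [N NP] := alpha_cvg e0.
pose M := maxn n N.
have nM : (n <= M)%N by exact: leq_maxl.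
apply: (le_trans (step _ nM)).
have h1 : S * \sum_(n.+1 <= m < M.+1) m%:R * gamma m <= S * eps.
  by rewrite ler_wpM2l// gamma_sum// leqW.
(* Convergence of [beta] to 0 does not control the boundary term (M - n) beta M; the moment bound
   does, and accounts for the second S eps. *)
have h2 := first_moment_beta (leq_trans nn nM).
have h3 : (M - n)%:R * beta M <= M.+1%:R * beta M.
  by rewrite ler_wpM2r// ler_nat leqW// leq_subr.
have h4 := NP M (leq_maxr _ _).
by lra.
Qed.

End Halving.

(** * Triviality of the kernel *)

Section Kernel.
Variable R : realType.
Implicit Types (a v y w : int -> R[i]) (c : int -> R).

(** If [y] vanishes at n + 1 and n + 2, the equation at n + 1 reduces to a n y n = 0. *)
Lemma jacobi_vanish_left a v y (N : int) : (forall n, a n != 0) ->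
  (forall n, jacobi a v y n = 0) -> (forall n, N <= n -> y n = 0) ->
  y = fun=> 0.
Proof.
move=> a0 Ly yN.
have h (k : nat) : forall n, N - k%:Z <= n -> y n = 0.
  elim: k => [|k IH] n; first by rewrite subr0; exact: yN.
  move=> nk; have [/IH//|lt] := leP (N - k%:Z) n.
  have := Ly (n + 1); rewrite /jacobi addrK.
  rewrite (IH (n + 1 + 1)) ?(IH (n + 1)); [|lia..].
  rewrite !(mulr0, subr0, sub0r, addr0, mulrN) opprK => /eqP.
  by rewrite mulf_eq0 (negPf (a0 _)) /= => /eqP.
by apply/funext => n; apply: (h (absz (N - n))); lia.
Qed.

Lemma ell2_cvg0 y (e : R) : ell2 y -> 0 < e ->
  exists N : nat, forall m, (N <= m)%N -> cmod (y m) <= e.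
Proof.
move=> /ell2_sums_le yY e0.
have [t tP] := sums_le_tail (exprn_gt0 2 e0) yY.
exists (\max_(n <- t) absz n).+1 => m mN.
rewrite -(@ler_pXn2r _ 2 isT) ?nnegrE ?cmod_ge0 ?(ltW e0)//.
have := tP [:: m%:Z] isT; rewrite big_seq1 /= => h; apply: h => n.
rewrite inE => /eqP ->; apply/negP => mt.
have := @leq_bigmax_seq _ t xpredT absz m mt isT.
by rewrite leqNgt; move: mN => /[swap] /negP + h; apply; exact: h.
Qed.

(** The supremum S of |y m| over m >= n0 satisfies S <= S / 2, so [y] vanishes far to the right and
    then everywhere by the recursion to the left. *)
Lemma jacobi_kernel a v (z : R[i]) c C y : (forall n, a n != 0) ->
  near_free a v z c -> weight_summable c C -> cmod z = 1 ->
  ell2 y -> (forall n, jacobi a v y n = 0) -> y = fun=> 0.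
Proof.
move=> a0 nf ws z1 yl Ly.
have z0 := cmod1_neq0 z1.
(* The stencil is at most 3 S and [first_moment_alpha] costs a factor 2, so 1/12 produces S / 2. *)
have e12 : 0 < 1 / 12 :> R by rewrite divr_gt0.
have [t tP] := sums_le_tail e12 ws.2.
(* Strictly above every |n| in [t], so that sites from [n0] on avoid [t]. *)
pose n0 := (\max_(n <- t) absz n).+1.
pose u n := y (n + 1) - z * y n.
pose E := [set cmod (y m) | m in [set m : nat | (n0 <= m)%N]].
have E0 : E !=set0 by exists (cmod (y n0)); exists n0 => /=.
have Eub : has_ubound E.
  exists (1 + l2sq y) => _ [m _ <-].
  have := cmod_le_l2sq m yl; have := sqr_ge0 (cmod (y m) - 1).
  by have := cmod_ge0 (y m); rewrite !expr2; nra.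
pose S := sup E.
have yS m : (n0 <= m)%N -> cmod (y m) <= S.
  by move=> nm; apply: ub_le_sup => //; exists m.
have S0 : 0 <= S by apply: le_trans (yS n0 _) => //; exact: cmod_ge0.
(* The two recursions are the two factors of [free_op]; as [y] is in the kernel, [free_op z y] is
   bounded by c times the stencil. *)
have halve m : (n0 <= m)%N -> cmod (y m) <= 2 * (3 * S * (1 / 12)).
  apply: (@first_moment_alpha R (fun m => cmod (y m)) (fun m => cmod (u m)) (fun m => c m)).
  - by move=> k; exact: cmod_ge0.
  - by move=> k; exact: ws.1.
  - move=> k _; have -> : cmod (y k) = cmod (y k.+1%:Z - u k).
      by rewrite /u -[k.+1]addn1 PoszD opprB addrC subrK cmodM z1 mul1r.
    exact: cmodB.
  - move=> k nk.
    have -> : u k = z * (u k.+1 - free_op z y k.+1).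
      rewrite free_op_factor// /u -[k.+1]addn1 PoszD addrK.
      by field.
    rewrite cmodM z1 mul1r (le_trans (cmodB _ _))// lerD2l.
    have := nf y k.+1; rewrite Ly sub0r cmodN => /le_trans; apply.
    rewrite mulrC ler_wpM2r ?ws.1//.
    rewrite /stencil (_ : k.+1%:Z - 1 = k); last by lia.
    rewrite (_ : k.+1%:Z + 1 = k.+2); last by lia.
    have := yS k nk; have := yS k.+1 (leqW nk); have := yS k.+2 (leqW (leqW nk)).
    by lra.
  - by move=> e; exact: ell2_cvg0.
  - move=> e e0; have [N NP] := ell2_cvg0 yl (divr_gt0 e0 (ltr0n _ 2)).
    exists N => k Nk; rewrite (le_trans (cmodB _ _))// cmodM z1 mul1r.
    have := NP k Nk; have := NP k.+1 (leqW Nk).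
    by rewrite -[k.+1]addn1 PoszD; lra.
  - by rewrite mulr_ge0.
  - move=> k N nk.
    have us : uniq [seq i%:Z | i <- index_iota k N].
      by rewrite map_inj_uniq ?iota_uniq// => i j [].
    have := tP _ us; rewrite big_map => h; apply: le_trans (h _).
      apply: ler_sum => i _; rewrite ler_wpM2r ?ws.1//=.
      by rewrite [leRHS](_ : _ = 1 + i%:R) ?lerDr.
    move=> n nk'; have [i + ->] := elimT mapP nk'; rewrite mem_index_iota => /andP[ki _].
    apply/negP => it; have := @leq_bigmax_seq _ t xpredT absz i it isT.
    by apply/negP; rewrite -ltnNge; exact: (leq_trans nk).
have Sle : S <= S / 2.
  by apply: ge_sup => // _ [m nm <-]; apply: (le_trans (halve m nm)); lra.
apply: (@jacobi_vanish_left a v y n0%:Z a0 Ly) => n.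
case: n => // m nm; apply: Normc.eq0_normc; apply/eqP.
by rewrite eq_le cmod_ge0 andbT; apply: (le_trans (yS m nm)); lra.
Qed.

End Kernel.

(** * Unboundedness of the inverse *)

Section NoInverse.
Variable R : realType.
Implicit Types (a v y w : int -> R[i]) (c : int -> R).

Definition truncated_wave (z : R[i]) (k : nat) : int -> R[i] := fun n =>
  if (0 <= n) && (n < k%:Z) then z ^+ absz n else 0.

(** A wave truncated to k sites has squared norm k, while its image has squared norm at most [D] for
    every k >= 2. *)
Lemma jacobi_unbounded_inverse a v (z : R[i]) c C :
  near_free a v z c -> weight_summable c C -> cmod z = 1 ->
  ~ l2_bounded_inverse (jacobi a v).
Proof.
move=> nf ws z1 [M MP].
have z0 := cmod1_neq0 z1.
have C0 : 0 <= C by exact: sums_le_ge0 ws.2.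
(* The free part is nonzero at four edge sites at most, with modulus at most 4. The perturbation is
   at most 3 c n, and 2 (3 c n)^2 sums to at most 18 C C because (c n)^2 <= C (1 + |n|) c n. *)
pose D := 2 * (4 * 16) + 18 * C * C.
suff main k : (2 <= k)%N -> k%:R <= M ^+ 2 * D.
  have D0 : 0 <= M ^+ 2 * D.
    by rewrite mulr_ge0 ?sqr_ge0// addr_ge0// ?mulr_ge0.
  have := main (Num.bound (M ^+ 2 * D)).+2 isT; rewrite leNgt => /negP; apply.
  by apply: (lt_le_trans (archi_boundP D0)); rewrite ler_nat; do 2 apply: leqW.
move=> k2; pose y := truncated_wave z k.
have y1 n : cmod (y n) <= 1.
  by rewrite /y /truncated_wave; case: ifP; rewrite ?cmodX ?z1 ?expr1n ?cmod0.
pose s := [seq i%:Z | i <- iota 0 k].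
have us : uniq s by rewrite map_inj_uniq ?iota_uniq// => i j [].
have ys : sums_le (fun n => cmod (y n) ^+ 2) k%:R.
  have -> : k%:R = \sum_(n <- s) (1 : R).
    by rewrite big_map big_const_seq count_predT size_iota iter_addr_0.
  apply: (sums_leW _ (lexx _) (sums_le_finsupp us (fun=> ler01))) => n /=.
  case: ifPn => [_|ns]; first by rewrite expr_le1 ?cmod_ge0.
  rewrite /y /truncated_wave ifF ?cmod0 ?expr0n//; apply/negP => /andP[n0 nk].
  move/negP: ns; apply; apply/mapP; exists (absz n); last by lia.
  by rewrite mem_iota; lia.
have ky : k%:R <= l2sq y.
  have := ell2_sums_le (sums_le_ell2 ys).1 us.
  rewrite big_map (eq_big_seq (fun=> 1)) => [|i]; last first.
    rewrite mem_iota => /andP[_ ik]; rewrite /y /truncated_wave.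
    by rewrite ifT ?cmodX ?z1 ?expr1n//; lia.
  by rewrite big_const_seq count_predT size_iota iter_addr_0.
(* The edge sites are distinct because k >= 2. *)
pose t := [:: -1; 0; k%:Z - 1; k%:Z].
have ut : uniq t by rewrite /t /= !inE; lia.
have Lt n : cmod (free_op z y n) ^+ 2 <= if n \in t then 16 else 0.
  case: ifPn => nt.
    rewrite (_ : 16 = 4 ^+ 2); last by ring.
    rewrite ler_pXn2r ?nnegrE ?cmod_ge0// /free_op.
    rewrite (le_trans (cmodB _ _))//.
    have zV : cmod z^-1 = 1 by rewrite Normc.normcV z1 invr1.
    have : cmod ((z + z^-1) * y n) <= 2 * 1.
      rewrite cmodM ler_pM ?cmod_ge0//.
      by rewrite (le_trans (cmodD _ _))// z1 zV.
    by have := cmodD (y (n + 1)) (y (n - 1)); have := y1 (n+1); have := y1 (n - 1); lra.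
  suff -> : free_op z y n = 0 by rewrite cmod0 expr0n.
  have [n0 nk] : n != 0 /\ n != k by move: nt; rewrite !inE; lia.
  have [n1 nk1] : n != -1 /\ n != k%:Z - 1 by move: nt; rewrite !inE; lia.
  rewrite /free_op /y /truncated_wave.
  have [nneg|npos] := ltP n 0.
    rewrite !ifF; [by rewrite mulr0 subr0 addr0|lia..].
  have [nlt|nge] := ltP n k.
    rewrite !ifT; [|lia..].
    case: n {nt} npos n0 nk n1 nk1 nlt => [[//|m]|m] *; last by lia.
    rewrite (_ : absz (m.+1%:Z + 1) = m.+2); last by lia.
    rewrite (_ : absz (m.+1%:Z - 1) = m); last by lia.
    by rewrite /= !exprS; field.
  rewrite !ifF; [by rewrite mulr0 subr0 addr0|lia..].
have Ly : sums_le (fun n => cmod (jacobi a v y n) ^+ 2) D.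
  apply: (sums_leW _ (lexx _) (sums_leD
    (sums_leZ (ler0n _ 2) (sums_leW (fun=> lexx _) _ (sums_le_finsupp ut (fun=> ler0n R 16))))
    (sums_leZ (mulr_ge0 (ler0n _ 18) C0) ws.2))); last first.
    by rewrite big_const_seq count_predT /= !addr0; lra.
  move=> n /=.
  have c0 := ws.1 n; have cC := weight_summable_bnd n ws.
  have le1 : cmod (jacobi a v y n) <= cmod (free_op z y n) + 3 * c n.
    rewrite -[jacobi a v y n](subrK (free_op z y n)) addrC.
    rewrite (le_trans (cmodD _ _))// lerD2l (le_trans (nf y n))// mulrC ler_wpM2r//.
    by rewrite /stencil; have := y1 (n-1); have := y1 n; have := y1 (n+1); lra.
  have le2 : c n ^+ 2 <= C * ((1 + `|n|%:~R) * c n).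
    rewrite expr2 ler_pM// ler_peMl// lerDl ler0z//.
  apply: (@le_trans _ _ ((cmod (free_op z y n) + 3 * c n) ^+ 2)).
    by rewrite ler_pXn2r ?nnegrE ?(le_trans _ le1) ?cmod_ge0.
  have := Lt n; have := sqr_ge0 (cmod (free_op z y n) - 3 * c n).
  move: le2; rewrite sqrrB sqrrD exprMn -!mulrA.
  move: (if _ then _ else _) ((1 + _) * c n) (cmod _) => T w x.
  by lra.
have [yl _] := sums_le_ell2 ys; have [Lyl LyD] := sums_le_ell2 Ly.
have MM := MP y (conj yl Lyl).
apply: (le_trans ky); rewrite -sqr_l2norm.
apply: (@le_trans _ _ ((M * l2norm (jacobi a v y)) ^+ 2)).
  by rewrite ler_pXn2r ?nnegrE ?(le_trans _ MM) ?sqrtr_ge0.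
by rewrite exprMn sqr_l2norm ler_wpM2l ?sqr_ge0.
Qed.

End NoInverse.

(** * Density of the range *)

Section Density.
Variable R : realType.
Implicit Types (a v f g h y w : int -> R[i]) (s t : seq int).

Definition finsupp y := exists s, forall n, n \notin s -> y n = 0.

Lemma finsupp_ell2 y : finsupp y -> ell2 y.
Proof.
move=> [s ys].
have h := @sums_le_finsupp R (fun n => cmod (y n) ^+ 2) (undup s) (undup_uniq s)
  (fun n => sqr_ge0 _).
refine (proj1 (@sums_le_ell2 R y _ (sums_leW _ (lexx _) h))) => n /=.
by rewrite mem_undup; case: ifPn => // /ys ->; rewrite cmod0 expr0n.
Qed.

Lemma finsuppD y w : finsupp y -> finsupp w -> finsupp (y \+ w).
Proof.
move=> [s ys] [t wt]; exists (s ++ t) => n.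
by rewrite mem_cat negb_or => /andP[/ys yn /wt wn]; rewrite /= yn wn addr0.
Qed.

Lemma finsuppB y w : finsupp y -> finsupp w -> finsupp (y \- w).
Proof.
move=> [s ys] [t wt]; exists (s ++ t) => n.
by rewrite mem_cat negb_or => /andP[/ys yn /wt wn]; rewrite /= yn wn subr0.
Qed.

Lemma finsuppZ (k : R[i]) y : finsupp y -> finsupp (fun n => k * y n).
Proof. by move=> [s ys]; exists s => n /ys ->; rewrite mulr0. Qed.

Lemma finsupp_jacobi a v y : finsupp y -> finsupp (jacobi a v y).
Proof.
move=> [s ys]; exists (s ++ [seq n + 1 | n <- s] ++ [seq n - 1 | n <- s]) => n.
rewrite !mem_cat !negb_or => /and3P[n1 n2 n3].
have z1 : y (n + 1) = 0.
  by apply: ys; apply: contra n3 => h; rewrite -[n](addrK 1); exact: map_f.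
have z2 : y (n - 1) = 0.
  by apply: ys; apply: contra n2 => h; rewrite -[n](subrK 1); exact: (map_f (fun m => m + 1)).
by rewrite /jacobi z1 z2 (ys n)//; ring.
Qed.

(** The real part of the Hermitian product; it is the cross term in the expansion of a squared
    modulus along real multiples. *)
Definition rdot (x y : R[i]) : R := Re x * Re y + Im x * Im y.

Lemma cmod_sqrD (x y : R[i]) (t : R) :
  cmod (x + t%:C * y) ^+ 2 =
  cmod x ^+ 2 + (2 * t * rdot x y + t ^+ 2 * cmod y ^+ 2).
Proof. by rewrite !cmod_sqr /rdot; case: x => ? ?; case: y => ? ? /=; ring. Qed.

(** Expansion of the squared norm of h + t g, where the cross term is a finite sum because [g] is
    supported on [s]. *)
Lemma sums_le_expand h g s (S t : R) : uniq s ->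
  (forall n, n \notin s -> g n = 0) ->
  sums_le (fun n => cmod (h n) ^+ 2) S ->
  sums_le (fun n => cmod (h n + t%:C * g n) ^+ 2)
   (S + (2 * t * \sum_(n <- s) rdot (h n) (g n) + t ^+ 2 * \sum_(n <- s) cmod (g n) ^+ 2)).
Proof.
move=> us gs hS r ur.
pose F n := cmod (h n + t%:C * g n) ^+ 2.
pose G n := 2 * t * rdot (h n) (g n) + t ^+ 2 * cmod (g n) ^+ 2.
have G0 n : n \notin s -> G n = 0.
  by move=> /gs gn; rewrite /G /rdot gn cmod0 expr0n /= !(mulr0, addr0).
pose rest := [seq n <- r | n \notin s].
have uc : uniq (s ++ rest).
  rewrite cat_uniq us filter_uniq// andbT /=; apply/hasPn => n /=.
  by rewrite mem_filter => /andP[].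
(* The list is first enlarged to contain all of [s], so that the cross terms, of either sign, appear
   in full. *)
apply: (@le_trans _ _ (\sum_(n <- s ++ rest) F n)).
  rewrite big_cat /= [leLHS](bigID (mem s)) /= /rest big_filter lerD2r -big_filter.
  rewrite [leRHS](bigID (mem r)) /= -[X in _ <= X + _]big_filter.
  rewrite (perm_big [seq n <- s | n \in r]) /=; last first.
    by apply: uniq_perm; rewrite ?filter_uniq// => n; rewrite !mem_filter andbC.
  by rewrite lerDl sumr_ge0// => n _; exact: sqr_ge0.
rewrite (eq_bigr (fun n => cmod (h n) ^+ 2 + G n)) => [|n _]; last exact: cmod_sqrD.
rewrite big_split /= lerD ?hS//.
rewrite big_cat /= [X in _ + X]big_seq [X in _ + X]big1 ?addr0; last first.
  by move=> n; rewrite mem_filter => /andP[/G0].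
by rewrite big_split /= -!mulr_sumr.
Qed.

Lemma ccvg_rdot (U : set_system nat) {UU : UltraFilter U} (w : nat -> int -> R[i])
    W g s : (forall n, ccvg U (w ^~ n) (W n)) ->
  \sum_(n <- s) rdot (w k n) (g n) @[k --> U] --> \sum_(n <- s) rdot (W n) (g n).
Proof.
move=> wW; elim: s => [|n s IH].
  by rewrite big_nil; under eq_cvg do rewrite big_nil; exact: cvg_cst.
rewrite big_cons; under eq_cvg do rewrite big_cons.
apply: cvgD => //; have [r i] := wW n.
by apply: cvgD; apply: cvgM => //; exact: cvg_cst.
Qed.

Lemma ultra_lim_ge0 (U : set_system nat) {UU : UltraFilter U} (X : nat -> R) x :
  (forall N, U [set k | (N <= k)%N]) -> X @ U --> x ->
  (forall k, - k.+1%:R^-1 <= X k) -> 0 <= x.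
Proof.
move=> Uinf Xx Xk; apply/ler_addgt0Pr => e e0; rewrite -lerBlDr sub0r.
apply: (cvgr_to_ge Xx).
apply: (@filterS _ U _ _ _ _ (Uinf (Num.bound e^-1))) => k /= ek.
apply: le_trans (Xk k); rewrite lerN2 invf_ple ?posrE//.
have ei : 0 <= e^-1 by rewrite invr_ge0 ltW.
by rewrite (le_trans (ltW (archi_boundP ei)))// ler_nat leqW.
Qed.

(* The transpose of [jacobi a v] is [jacobi a v] itself. *)
Lemma jacobi_transpose a v w :
  (forall y, finsupp y -> forall s, uniq s ->
    (forall n, n \notin s -> jacobi a v y n = 0) ->
    \sum_(n <- s) rdot (w n) (jacobi a v y n) = 0) ->
  forall j, jacobi a v (fun n => (w n)^*) j = 0.
Proof.
move=> orth j; pose k := (jacobi a v (fun n => (w n)^*) j)^*.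
pose y n : R[i] := if n == j then k else 0.
have yf : finsupp y.
  by exists [:: j] => n; rewrite inE /y => /negPf ->.
have yj : y j = k by rewrite /y eqxx.
have yn n : n != j -> y n = 0 by rewrite /y => /negPf ->.
have us : uniq [:: j - 1; j; j + 1] by rewrite /= !inE; lia.
have out n : n \notin [:: j - 1; j; j + 1] -> jacobi a v y n = 0.
  rewrite !inE => nj; rewrite /jacobi !yn; [by ring|lia..].
have kZ : Re (jacobi a v (fun n => (w n)^*) j * k) = 0.
  rewrite -[RHS](orth y yf _ us out) !big_cons big_nil addr0.
  have rdotE (x z : R[i]) : rdot x z = Re (x^* * z).
    by case: x => ? ?; case: z => ? ?; rewrite /rdot /= mulNr opprK.
  have jm : j - 1 + 1 = j by lia.
  have jp : j + 1 - 1 = j by lia.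
  rewrite !rdotE -!raddfD /jacobi jm jp yj.
  rewrite (yn (j - 1)) ?(yn (j + 1)) ?(yn (j - 1 - 1)) ?(yn (j + 1 + 1)); [|lia..].
  by congr Re; ring.
move: kZ; rewrite /k; move: (jacobi _ _ _ _) => [r i] h.
have : r ^+ 2 + i ^+ 2 = 0 by rewrite -[RHS]h /=; ring.
by move/eqP; rewrite paddr_eq0 ?sqr_ge0// !sqrf_eq0 => /andP[/eqP -> /eqP ->].
Qed.

(* If [f] stays at distance [sqrt d] from the range, the residuals [h k] of a
   minimizing sequence have a weak limit orthogonal to the range, hence zero;
   then [|(h j + h k) / 2|^2] is close to [d / 2] for large [j], below the minimum. *)
Lemma finsupp_approx a v f (e : R) : 0 < e ->
  (forall y, ell2 y -> (forall n, jacobi a v y n = 0) -> y = fun=> 0) ->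
  finsupp f -> exists2 y, finsupp y & l2sq (f \- jacobi a v y) < e.
Proof.
move=> e0 ker fs; apply: contrapT => noy.
pose H y := f \- jacobi a v y.
have Hfs y : finsupp y -> finsupp (H y).
  by move=> ys; apply: finsuppB => //; exact: finsupp_jacobi.
pose E := [set l2sq (H y) | y in [set y | finsupp y]].
have fs0 : finsupp (fun=> 0) by exists [::].
have E0 : E !=set0 by exists (l2sq (H (fun=> 0))); exists (fun=> 0).
have Ee : lbound E e.
  move=> _ [y ys <-]; rewrite leNgt; apply/negP => h; apply: noy.
  by exists y.
pose d := inf E.
have ed : e <= d by exact: lb_le_inf.
have d0 : 0 < d by apply: lt_le_trans ed.
have dH y : finsupp y -> d <= l2sq (H y).
  by move=> ys; apply: ge_inf; [exists e|exists y].
have /choice[y yP] : forall k : nat, exists y, finsupp y /\ l2sq (H y) <= d + k.+1%:R^-1.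
  move=> k; have k0 : 0 < k.+1%:R^-1 :> R by rewrite invr_gt0 ltr0n.
  have [] := @inf_adherent R E _ k0; first by split=> //; exists e.
  by move=> _ [y ys <-] /ltW; exists y.
pose h k := H (y k).
have hsum k : sums_le (fun n => cmod (h k n) ^+ 2) (d + k.+1%:R^-1).
  have [/Hfs/finsupp_ell2/ell2_sums_le yl le] := yP k.
  exact: (sums_leW (fun=> lexx _) le yl).
have [U [UU Uinf]] := ex_ultrafilter_nat.
have [|W hW] := @ultra_ccvg R U h (d + 1) UU.
  move=> k n; apply: (le_trans (sums_le_term (hsum k) n)).
  by rewrite lerD2l invf_le1 ?ltr0n// ler1n.
have Wl : ell2 W.
  apply: (proj1 (sums_le_ell2 (sums_le_ccvg hW (M := d + 1) _))) => k.
  apply: (sums_leW (fun=> lexx _) _ (hsum k)).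
  by rewrite lerD2l invf_le1 ?ltr0n// ler1n.
have orth x : finsupp x -> forall s, uniq s ->
    (forall n, n \notin s -> jacobi a v x n = 0) ->
    \sum_(n <- s) rdot (W n) (jacobi a v x n) = 0.
  move=> xs s us gs; set b := \sum_(n <- s) _.
  pose q := \sum_(n <- s) cmod (jacobi a v x n) ^+ 2.
  have q0 : 0 <= q by apply: sumr_ge0 => n _; exact: sqr_ge0.
  (* Moving y k by - t x adds t times the image of x to the residual. Minimality of [d] bounds the
     expression from below by - 1 / (k + 1), and the limit is taken along [U]. *)
  have pos (t : R) : 0 <= 2 * t * b + t ^+ 2 * q.
    apply: (@ultra_lim_ge0 U UU (fun k =>
      2 * t * \sum_(n <- s) rdot (h k n) (jacobi a v x n) + t ^+ 2 * q)) => //.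
      apply: cvgD; last exact: cvg_cst.
      by apply: cvgM; [exact: cvg_cst|exact: ccvg_rdot].
    move=> k; have [ys _] := yP k.
    have := dH (y k \- (fun n => t%:C * x n)) (finsuppB ys (finsuppZ _ xs)).
    have [_] := sums_le_ell2 (sums_le_expand t us gs (hsum k)).
    have -> : (fun n => h k n + t%:C * jacobi a v x n) = H (y k \- (fun n => t%:C * x n)).
      by apply/funext => n; rewrite /h /H jacobiB jacobiZ /=; ring.
    rewrite -/q; move: (l2sq _) (k.+1%:R^-1) (\sum_(n <- s) _) => *; lra.
  have q1 : 0 < q + 1 by lra.
  (* The denominator q + 1 covers the case q = 0; the value is a negative multiple of the square of
     b / (q + 1), which forces b = 0. *)
  have := pos (- (b / (q + 1))).
  have -> : 2 * - (b / (q + 1)) * b + (- (b / (q + 1))) ^+ 2 * q =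
      - ((q + 2) * (b / (q + 1)) ^+ 2) by field; rewrite gt_eqF.
  rewrite oppr_ge0 pmulr_rle0; last by lra.
  move=> le0; have : (b / (q + 1)) ^+ 2 == 0 by rewrite eq_le le0 sqr_ge0.
  by rewrite sqrf_eq0 mulf_eq0 invr_eq0 (gt_eqF q1) orbF => /eqP.
have W0 n : W n = 0.
  have : (fun n => (W n)^*) = fun=> 0.
    apply: ker; last exact: jacobi_transpose.
    have := ell2_sums_le Wl => /(sums_leW _ (lexx _)) Wl'.
    by apply: (proj1 (sums_le_ell2 (Wl' _ _))) => m; rewrite cmodJ.
  move=> /(congr1 (fun g => g n)) /= Wn.
  by apply: Normc.eq0_normc; rewrite -cmodJ Wn cmod0.
(* One index is frozen with residual of squared norm at most 3 d / 2. Its residual has finite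
   support, so its products with the other residuals pass to the weak limit. *)
pose k := Num.bound (d / 2)^-1.
have kd : k.+1%:R^-1 <= d / 2.
  have dd : 0 < d / 2 by rewrite divr_gt0.
  rewrite invf_ple ?posrE// ?ltr0n//; have ei : 0 <= (d / 2)^-1 by rewrite invr_ge0 ltW.
  by rewrite (le_trans (ltW (archi_boundP ei)))// ler_nat leqW.
have [yks hk] := yP k.
have [s0 s0P] := Hfs _ yks.
pose s := undup s0.
have us : uniq s by exact: undup_uniq.
have hs n : n \notin s -> h k n = 0 by rewrite mem_undup; exact: s0P.
suff : 0 <= - (3 / 2) * d + 2 * \sum_(n <- s) rdot (W n) (h k n).
  by rewrite big1 => [|n _]; [lra|rewrite W0 /rdot /= !mul0r addr0].
apply: (@ultra_lim_ge0 U UU (fun j =>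
  - (3 / 2) * d + 2 * \sum_(n <- s) rdot (h j n) (h k n))) => //.
  apply: cvgD; first exact: cvg_cst.
  by apply: cvgM; [exact: cvg_cst|exact: ccvg_rdot].
move=> j; have [yjs _] := yP j.
have half : 0 <= 1 / 4 :> R by rewrite divr_ge0.
have S1 := sums_leZ half (sums_le_expand 1 us hs (hsum j)).
(* The residual of the midpoint is the midpoint of the residuals: 4 d <= (d + 1 / (j + 1)) + 2
   [rdot] sum + 3 d / 2. *)
have := dH (fun n => 2^-1%:C * (y j \+ y k) n) (finsuppZ _ (finsuppD yjs yks)).
have [|_] := @sums_le_ell2 R (H (fun n => 2^-1%:C * (y j \+ y k) n)) _
  (sums_leW _ (lexx _) S1).
  move=> n /=.
  have -> : H (fun m => 2^-1%:C * (y j \+ y k) m) n = 2^-1%:C * (h j n + 1%:C * h k n).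
    rewrite rmorph1 mul1r /h /H jacobiZ jacobiD /=.
    have : 2^-1%:C + 2^-1%:C = 1 :> R[i]
      by rewrite -rmorphD /= -[RHS]/(1%:C); congr (_%:C); lra.
    by move: (2^-1%:C) => c c1; rewrite -[f n in LHS]mul1r -c1; ring.
  rewrite cmodM exprMn cmod_real ger0_norm ?invr_ge0// ler_wpM2r ?sqr_ge0//.
  by rewrite expr2; lra.
have hk2 : \sum_(n <- s) cmod (h k n) ^+ 2 <= d + d / 2.
  by apply: (le_trans (hsum k _ us)); rewrite lerD2l.
by move: hk2; move: (\sum_(n <- s) _) (\sum_(n <- s) _) (j.+1%:R^-1) => *; lra.
Qed.

(** Reduction to finitely supported [f] by truncation. The errors combine to less than 2 e^2 / 8 + 2
    e^2 / 4, which is below e^2. *)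
Lemma jacobi_dense a v :
  (forall y, ell2 y -> (forall n, jacobi a v y n = 0) -> y = fun=> 0) ->
  l2_dense (l2_range (jacobi a v)).
Proof.
move=> ker f /ell2_sums_le fl e e0.
have e2 : 0 < e ^+ 2 by exact: exprn_gt0.
have [|t tP] := sums_le_tail _ fl (e := e ^+ 2 / 8); first by rewrite divr_gt0.
pose f' n := if n \in t then f n else 0.
have f's : finsupp f' by exists t => n /negPf nt; rewrite /f' nt.
have [|y ys yf] := @finsupp_approx a v f' (e ^+ 2 / 4) _ ker f's.
  by rewrite divr_gt0.
have rem : sums_le (fun n => cmod (f n - f' n) ^+ 2) (e ^+ 2 / 8).
  move=> s us; rewrite (bigID (mem t)) /= big1 => [|n nt]; last first.
    by rewrite /f' nt subrr cmod0 expr0n.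
  rewrite add0r -big_filter (eq_big_seq (fun n => cmod (f n) ^+ 2)).
    by apply: tP; rewrite ?filter_uniq// => n; rewrite mem_filter => /andP[].
  by move=> n; rewrite mem_filter /f' => /andP[/negPf -> _]; rewrite subr0.
exists (jacobi a v y).
  exists y => //; split; first exact: finsupp_ell2.
  exact/finsupp_ell2/finsupp_jacobi.
rewrite l2norm_lt//.
have /ell2_sums_le yl : ell2 (f' \- jacobi a v y).
  by apply: finsupp_ell2; apply: finsuppB => //; exact: finsupp_jacobi.
have := sums_leD (sums_leZ (ler0n _ 2) rem) (sums_leZ (ler0n _ 2) yl).
move=> /(sums_leW _ (lexx _)) h; have {h} := h (fun n => cmod ((f \- jacobi a v y) n) ^+ 2).
move=> h; have [|_] := sums_le_ell2 (h _); last by lra.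
move=> n /=.
have -> : f n - jacobi a v y n = (f n - f' n) + (f' n - jacobi a v y n) by ring.
have := cmodD (f n - f' n) (f' n - jacobi a v y n).
have := cmod_ge0 (f n - f' n + (f' n - jacobi a v y n)).
have := sqr_ge0 (cmod (f n - f' n) - cmod (f' n - jacobi a v y n)).
by move: (cmod _) (cmod _) (cmod _) => r p q; rewrite !expr2; nra.
Qed.

End Density.

(** * The pencil *)

Section PencilWeights.
Variable R : realType.
Implicit Types (a p q y : int -> R[i]).

Lemma summable_sums_le (F : int -> R) : (forall n, 0 <= F n) ->
  summable [set: int] (fun n => (F n)%:E) -> exists C, sums_le F C.
Proof.
move=> F0; rewrite /summable; under eq_esum do rewrite gee0_abs ?lee_fin//.
move=> h; exists (fine (\esum_(n in [set: int]) (F n)%:E)).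
apply/esum_sums_le => //; rewrite fineK// ge0_fin_numE//.
by apply: esum_ge0 => n _; rewrite lee_fin.
Qed.

(** The relation between [z] and [lam] cancels the constant coefficients. What remains involves 1 -
    a at n and n - 1, and p, q at n, whence two neighbouring terms of [d]; the factor [L] absorbs 2
    |lam|. *)
Lemma pencil_near_free a p q (lam z : R[i]) :
  summable [set: int] (fun n : int =>
    (`|n|%:~R * (cmod (1 - a n) + cmod (p n) + cmod (q n)))%:E) ->
  z + z^-1 = 2 - lam ^+ 2 ->
  exists c C, near_free a (fun n => q n + 2 * lam * p n + lam ^+ 2) z c /\
    weight_summable c C.
Proof.
move=> + zlam; pose d n := cmod (1 - a n) + cmod (p n) + cmod (q n).
have d0 n : 0 <= d n by rewrite !addr_ge0 ?cmod_ge0.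
have nn (n : int) : 0 <= `|n|%:~R :> R by rewrite ler0z.
move=> /summable_sums_le[|C0 dC]; first by move=> n; exact: mulr_ge0 (nn n) (d0 n).
(* The given weight |n| vanishes at 0, so d 0 is added separately; elsewhere 1 + |n| <= 2 |n|. *)
have dC1 : sums_le (fun n => (1 + `|n|%:~R) * d n) (2 * C0 + d 0).
  have h := @sums_le_finsupp R d [:: 0] isT d0.
  rewrite big_seq1 in h.
  apply: (sums_leW _ (lexx _) (sums_leD (sums_leZ (ler0n _ 2) dC) h)) => n /=.
  rewrite inE -/(d n); case: eqVneq => [->|n0]; first by rewrite normr0 /=; lra.
  have : 1 <= `|n| by lia.
  by rewrite -(ler_int R); have := d0 n; nra.
pose L := 1 + 2 * cmod lam.
have L1 : 1 <= L by have := cmod_ge0 lam; rewrite /L; lra.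
have L0 : 0 <= L by lra.
exists (fun n => L * (d n + d (n - 1))), (L * ((2 * C0 + d 0) + 2 * (2 * C0 + d 0))).
split; last first.
  split=> [n|]; first by rewrite mulr_ge0// addr_ge0.
  apply: (sums_leW _ (lexx _) (sums_leZ L0 (sums_leD dC1
    (sums_leZ (ler0n _ 2) (sums_le_shift (-1) dC1))))) => n /=.
  (* Hence 1 + |n| <= 2 (1 + |n - 1|), which is the factor 2 on the shifted sum. *)
  have : `|n| <= 1 + `|n - 1| by lia.
  rewrite -(ler_int R) intrD => h; rewrite mulrCA ler_wpM2l// mulrDr lerD2l mulrA ler_wpM2r//.
  by have := nn (n - 1); lra.
move=> y n /=; rewrite /jacobi /free_op zlam.
set X := cmod _.
have -> : X = cmod (((1 - a (n - 1)) * (y n - y (n - 1)) - (1 - a n) * (y (n + 1) - y n))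
   + (q n * y n + 2 * lam * p n * y n)).
  by rewrite /X; congr cmod; ring.
have two : cmod (2 : R[i]) = 2.
  by rewrite -[2]/(2%:R) -(rmorph_nat (real_complex R)) cmod_real ger0_norm.
have h1 := cmodD ((1 - a (n - 1)) * (y n - y (n - 1)) - (1 - a n) * (y (n + 1) - y n))
  (q n * y n + 2 * lam * p n * y n).
have h2 := cmodB ((1 - a (n - 1)) * (y n - y (n - 1))) ((1 - a n) * (y (n + 1) - y n)).
have h3 := cmodD (q n * y n) (2 * lam * p n * y n).
have h4 := ler_wpM2l (cmod_ge0 (1 - a (n - 1))) (cmodB (y n) (y (n - 1))).
have h5 := ler_wpM2l (cmod_ge0 (1 - a n)) (cmodB (y (n + 1)) (y n)).
rewrite !cmodM two in h2 h3.
rewrite /stencil {1 2}/d /L.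
move: h1 h2 h3 h4 h5; have := cmod_ge0 (y n); have := cmod_ge0 (y (n + 1)).
have := cmod_ge0 (y (n - 1)); have := cmod_ge0 lam; have := cmod_ge0 (p n).
have := cmod_ge0 (q n); have := cmod_ge0 (1 - a n); have := cmod_ge0 (1 - a (n - 1)).
have := cmod_ge0 (p (n - 1)); have := cmod_ge0 (q (n - 1)).
move: (cmod (y n)) (cmod (y (n + 1))) (cmod (y (n - 1))) (cmod lam) (cmod (p n)) (cmod (q n))
  (cmod (1 - a n)) (cmod (1 - a (n - 1))) (cmod (p (n - 1))) (cmod (q (n - 1))).
move=> y0 yp ym l p0 q0 b0 bm pm qm pm0 qm0 bm0 b00 q00 p00 l0 ym0 yp0 y00 h1 h2 h3 h4 h5.
apply: (le_trans h1).
pose D := b0 + p0 + q0 + (bm + pm + qm).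
have D1 : b0 * (yp + y0) + bm * (y0 + ym) + q0 * y0 + 2 * l * p0 * y0 <=
    (1 + 2 * l) * D * (ym + y0 + yp).
  have e1 : 0 <= b0 * ym by exact: mulr_ge0.
  have e2 : 0 <= bm * yp by exact: mulr_ge0.
  have e3 : 0 <= q0 * (ym + yp) by rewrite mulr_ge0// addr_ge0.
  have e4 : 0 <= 2 * l * p0 * (ym + yp) by rewrite !mulr_ge0// addr_ge0.
  have e5 : 0 <= 2 * l * (b0 + q0 + bm + pm + qm) * (ym + y0 + yp).
    by rewrite !mulr_ge0// !addr_ge0.
  have e6 : 0 <= (p0 + pm + qm) * (ym + y0 + yp) by rewrite !mulr_ge0// !addr_ge0.
  by rewrite /D; lra.
by rewrite /D in D1; lra.
Qed.

(** * Roots of z + z^-1 = 2 - lam^2 *)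

Lemma complex_invJ (z : R[i]) : cmod z = 1 -> z^-1 = (z^*)%C.
Proof.
move=> z1; have zz : z * (z^*)%C = 1.
  case: z z1 => r s /(congr1 (fun t => t ^+ 2)); rewrite cmod_sqr expr1n /= => h.
  by apply/eqP; rewrite eq_complex /=; apply/andP; split; apply/eqP; lra.
have z0 := cmod1_neq0 z1.
by apply: (mulfI z0); rewrite divff.
Qed.

(** On the unit circle z + z^-1 is twice the real part, so the real part must be 1 - x^2 / 2, which
    lies in [-1, 1]. *)
Lemma unit_root (x : R) : -2 <= x <= 2 ->
  exists2 z : R[i], cmod z = 1 & z + z^-1 = 2 - x%:C ^+ 2.
Proof.
move=> /andP[x1 x2]; pose c := 1 - x ^+ 2 / 2.
have c1 : 0 <= 1 - c ^+ 2.
  rewrite [leRHS](_ : _ = (x / 2) ^+ 2 * (2 - x) * (2 + x)); last by rewrite /c; field.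
  by apply: mulr_ge0; [apply: mulr_ge0; [exact: sqr_ge0|lra]|lra].
pose z := c +i* Num.sqrt (1 - c ^+ 2).
have z1 : cmod z = 1 by rewrite /= sqr_sqrtr// subrKC sqrtr1.
exists z => //; rewrite complex_invJ//.
have -> : 2 - x%:C ^+ 2 = (2 - x ^+ 2)%:C by rewrite rmorphB rmorphXn rmorph_nat.
by apply/eqP; rewrite eq_complex /= subrr eqxx andbT; apply/eqP; rewrite /c; field.
Qed.

(** Here lam^2 = 2 - 2 Re z is real and lies in [0, 4]; a nonnegative square excludes a nonzero
    imaginary part. *)
Lemma unit_root_real (z lam : R[i]) : cmod z = 1 -> z + z^-1 = 2 - lam ^+ 2 ->
  exists2 x : R, -2 <= x <= 2 & x%:C = lam.
Proof.
move=> z1; rewrite complex_invJ//.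
move: z1 => /(congr1 (fun t => t ^+ 2)); rewrite cmod_sqr expr1n.
move: z lam => [r s] [l m] /= rs /eqP.
rewrite eq_complex /= => /andP[/eqP e1 /eqP e2].
have lm : l * m = 0 by lra.
have r1 : - 1 <= r <= 1.
  by have := sqr_ge0 s; rewrite !expr2 in rs *; move=> ss; apply/andP; split; nra.
have m0 : m = 0.
  move/eqP: lm; rewrite mulf_eq0 => /orP[/eqP l0|/eqP//].
  apply/eqP; rewrite -sqrf_eq0 eq_le sqr_ge0 andbT expr2.
  by rewrite l0 in e1; lra.
exists l; last by rewrite m0.
by rewrite m0 in e1; apply/andP; split; nra.
Qed.

(** The two roots of z^2 - w z + 1 have product 1, so one lies inside the unit disc unless both lie
    on the circle, which [unit_root_real] excludes. *)
Lemma inner_root (lam : R[i]) : ~ (exists2 x : R, -2 <= x <= 2 & x%:C = lam) ->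
  exists z : R[i], [/\ z != 0, cmod z < 1 & z + z^-1 = 2 - lam ^+ 2].
Proof.
move=> nlam; pose w := 2 - lam ^+ 2.
pose del := sqrtc (w ^+ 2 - 4).
pose z := (w + del) / 2.
have zw : z * (w - z) = 1.
  have dd : del ^+ 2 = w ^+ 2 - 4 by exact: sqr_sqrtc.
  have -> : z * (w - z) = (w ^+ 2 - del ^+ 2) / 4 by rewrite /z; field.
  by rewrite dd; field.
have z0 : z != 0.
  by apply/eqP => z0; move/eqP: zw; rewrite z0 mul0r eq_sym oner_eq0.
have zV : z^-1 = w - z by apply: (mulfI z0); rewrite zw divff.
have [lt|gt|z1] := ltgtP (cmod z) 1.
- by exists z; rewrite zV addrC subrK.
- exists z^-1; split; first by rewrite invr_eq0.
    by rewrite Normc.normcV invf_lt1// (lt_trans ltr01).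
  by rewrite invrK zV subrK.
- by case: nlam; apply: (unit_root_real z1); rewrite zV addrC subrK.
Qed.

Lemma jacobi_set_inj a v :
  (forall y, ell2 y -> (forall n, jacobi a v y n = 0) -> y = fun=> 0) ->
  set_inj (l2_domain (jacobi a v)) (jacobi a v).
Proof.
move=> ker y w /[!inE] -[/ell2_sums_le yl _] [/ell2_sums_le wl _] yw.
have : y \- w = fun=> 0.
  apply: ker => [|n]; last by rewrite jacobiB yw /= subrr.
  have h := sums_leD (sums_leZ (ler0n _ 2) yl) (sums_leZ (ler0n _ 2) wl).
  apply: (proj1 (sums_le_ell2 (sums_leW _ (lexx _) h))) => n /=.
  have := cmodB (y n) (w n); have := cmod_ge0 (y n - w n).
  have := sqr_ge0 (cmod (y n) - cmod (w n)).
  by move: (cmod _) (cmod _) (cmod _) => r s t; rewrite !expr2; nra.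
move=> h; apply/funext => n; apply/eqP; rewrite -subr_eq0.
by rewrite -[y n - w n]/((y \- w) n) h.
Qed.

End PencilWeights.

(** * The two inclusions for the continuous spectrum *)

Unset Implicit Arguments.
Set Strict Implicit.

Theorem theorem2 (R : realType) (a p q : int -> R[i])
    (a_neq0 : forall n : int, a n != 0)
    (apq_summable : summable [set: int]
       (fun n : int =>
          (`|n|%:~R * (cmod (1 - a n) + cmod (p n) + cmod (q n)))%:E)) :
  continuous_spectrum (pencil a p q) =
  [set x%:C | x in [set x : R | -2 <= x <= 2]].
Proof.
apply/seteqP; split=> [lam [inj _ nb]|_ [x /unit_root[z z1 zx] <-]].
  (* Off the interval, injectivity yields a bounded inverse, against the third clause. *)
  apply: contrapT => nlam; apply: nb.
  have [z [z0 z1 zlam]] := inner_root nlam.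
  have [c [C [nf ws]]] := pencil_near_free apq_summable zlam.
  rewrite pencilE in inj *.
  exact: jacobi_bounded_inverse nf ws z0 z1 inj.
have [c [C [nf ws]]] := pencil_near_free apq_summable zx.
have ker y := @jacobi_kernel R a _ z c C y a_neq0 nf ws z1.
rewrite /continuous_spectrum /= pencilE; split.
- exact: jacobi_set_inj ker.
- exact: jacobi_dense ker.
- exact: jacobi_unbounded_inverse nf ws z1.
Qed.
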